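(* Let $A_1,\dots,A_m\in\mathbb{C}^{n\times n}$ be Hermitian matrices, let $h_1,\dots,h_m:\mathbb{R}\to\mathbb{R}$ be differentiable and non-decreasing, and let $\phi_i$ be an anti-derivative of $h_i$ ($\phi_i'=h_i$) for $i=1,\dots,m$. Put $H(x)=\sum_{i=1}^m h_i(x^HA_ix)\,A_i$ and $F(x)=\sum_{i=1}^m\phi_i(x^HA_ix)$ for $x\in\mathbb{C}^n$. Let $x\in\mathbb{C}^n$ be a unit vector. (a) If $x$ is a stable eigenvector of the mNEPv $H(x)x=\lambda x$, then $x$ is a strict local maximizer of the aMax $\max_{x\in\mathbb{C}^n,\ \|x\|=1}F(x)$. (b) If $x$ is a local maximizer of the aMax $\max_{x\in\mathbb{C}^n,\ \|x\|=1}F(x)$, then $x$ is a weakly stable eigenvector of the mNEPv $H(x)x=\lambda x$.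
   Context: $\|\cdot\|$ is the Euclidean norm and $\cdot^H$ the conjugate transpose. A unit vector $x\in\mathbb{C}^n$ is an eigenvector of the mNEPv (monotone eigenvector-dependent nonlinear eigenvalue problem) if $H(x)x=\lambda x$ for some $\lambda\in\mathbb{R}$ and, moreover, $\lambda$ $(=x^HH(x)x)$ is the largest eigenvalue of the Hermitian matrix $H(x)$. For $x_*\in\mathbb{C}^n$ and $d\in\mathbb{C}^n$ define $$\varphi(d;x_* ) := d^H\Big(H(x_* )-(x_*^HH(x_* )x_* )\,I\Big)d+2\sum_{i=1}^m h_i'(x_*^HA_ix_* )\,\big(\mathrm{Re}(d^HA_ix_* )\big)^2 .$$ An eigenvector $x_*$ of the mNEPv is called stable if $\varphi(d;x_* )<0$ for all $d\in\mathbb{C}^n$ with $d\neq0$ and $d^Hx_*=0$, and weakly stable if $\varphi(d;x_* )\le0$ for all $d\in\mathbb{C}^n$ with $d\ne0$ and $d^Hx_*=0$. A unit vector $x$ is a local maximizer of the aMax if there exists $\varepsilon>0$ such that $F(x)\ge F\big(\tfrac{x+d}{\|x+d\|}\big)$ for all $d\in\mathbb{C}^n$ with $d^Hx=0$ and $\|d\|\le\varepsilon$; it is a strict local maximizer if there exists $\varepsilon>0$ such that $F(x)>F\big(\tfrac{x+d}{\|x+d\|}\big)$ for all $d\in\mathbb{C}^n$ with $d\neq0$, $d^Hx=0$ and $\|d\|\le\varepsilon$. *)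

(* Defs.v *)
From HB Require Import structures.
From mathcomp Require Export all_boot all_order all_algebra sesquilinear spectral.
From mathcomp Require Export all_classical all_reals all_analysis.
From mathcomp Require Export complex.
Export numFieldNormedType.Exports.
Export Order.TTheory GRing.Theory Num.Theory.

Set Implicit Arguments.
Unset Strict Implicit.
Unset Printing Implicit Defensive.

#[global] Open Scope ring_scope.
#[global] Open Scope sesquilinear_scope.
#[global] Open Scope complex_scope.

Section MNEPv.
Context {R : realType} {m n : nat}.
Local Notation C := R[i].
Implicit Types (A : 'I_m -> 'M[C]_n) (h phi : 'I_m -> R -> R) (x d : 'cV[C]_n).

(* MathComp-Analysis' norm on matrices is the max norm, hence this Euclidean
   norm on C^n. *)
Definition enorm x : R :=
  Num.sqrt (\sum_(j < n) (complex.Re (x j 0) ^+ 2 + complex.Im (x j 0) ^+ 2)).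

(* Re (y^H M x) *)
Definition reform (M : 'M[C]_n) (y x : 'cV[C]_n) : R :=
  complex.Re ((y^t* *m M *m x) 0 0).

(* x^H M x; it is real for the Hermitian matrices M considered here, and taking
   the real part only serves to land in R. *)
Definition qform (M : 'M[C]_n) x : R := reform M x x.

Definition orthogonal_to d x : Prop := d^t* *m x = 0.

Definition Hmx A h x : 'M[C]_n := \sum_(i < m) (h i (qform (A i) x))%:C *: A i.

Definition Fobj A phi x : R := \sum_(i < m) phi i (qform (A i) x).

(* [eigenvalue] is defined by row eigenvectors; a square matrix has the same
   eigenvalues on both sides. In the order of R[i], mu <= lambda%:C says that mu
   is real and at most lambda. *)
Definition largest_eigenvalue (M : 'M[C]_n) (lambda : R) : Prop :=
  eigenvalue M lambda%:C /\
  forall mu : C, eigenvalue M mu -> mu <= lambda%:C.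

Definition mNEPv_eigenvector A h x : Prop :=
  enorm x = 1 /\
  exists lambda : R,
    Hmx A h x *m x = lambda%:C *: x /\ largest_eigenvalue (Hmx A h x) lambda.

Definition varphi A h d x : R :=
  qform (Hmx A h x - (qform (Hmx A h x) x)%:C%:M) d
  + 2 * \sum_(i < m) derive1 (h i) (qform (A i) x) * reform (A i) d x ^+ 2.

Definition stable_eigenvector A h x : Prop :=
  mNEPv_eigenvector A h x /\
  forall d, d != 0 -> orthogonal_to d x -> varphi A h d x < 0.

Definition weakly_stable_eigenvector A h x : Prop :=
  mNEPv_eigenvector A h x /\
  forall d, d != 0 -> orthogonal_to d x -> varphi A h d x <= 0.

Definition normalize x : 'cV[C]_n := (enorm x)^-1%:C *: x.

Definition aMax_local_maximizer (F : 'cV[C]_n -> R) x : Prop :=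
  enorm x = 1 /\
  exists2 eps : R, 0 < eps &
    forall d, orthogonal_to d x -> enorm d <= eps -> F (normalize (x + d)) <= F x.

Definition aMax_strict_local_maximizer (F : 'cV[C]_n -> R) x : Prop :=
  enorm x = 1 /\
  exists2 eps : R, 0 < eps &
    forall d, d != 0 -> orthogonal_to d x -> enorm d <= eps ->
      F (normalize (x + d)) < F x.

End MNEPv.

(* Main.v *)
Require Import Defs.
From mathcomp Require Import ring lra.

(** Everything rests on one expansion.  For d orthogonal to the unit vector x,
    the squared norm of x + d is 1 + |d|^2, so each form q_i(y) = y^H A_i y
    moves, from x to the normalized vector x + d, by
    s_i = (2 r_i + q_i(d) - |d|^2 q_i(x)) / (1 + |d|^2), with
    r_i = Re (d^H A_i x).  Differentiability of h_i at the single point q_i(x)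
    already gives phi_i a second-order Taylor expansion with Peano remainder
    there ([antiderivative_taylor2], by the mean value theorem).  Substituting
    s_i and summing yields ([Fobj_expansion])
      F((x + d)/|x + d|) = F(x) + 2 Re (d^H H(x) x) + varphi(d; x) + o(|d|^2).

    (a) If x is a stable eigenvector, the linear term vanishes since
    d^H x = 0, and varphi is negative on the nonzero vectors orthogonal to x.
    The unit sphere of that space is compact, so varphi(d; x) <= - c |d|^2 for
    some c > 0 ([coercive_quadratic]), and this dominates the remainder.

    (b) If x is a local maximizer, the expansion along t d, for real t of both
    signs, forces Re (d^H H(x) x) = 0 and varphi(d; x) <= 0
    ([second_order_necessary]).  Taking for d the residual
    H(x) x - (x^H H(x) x) x, which is orthogonal to x, shows that this residual
    is zero.  As h_i is non-decreasing, h_i' >= 0, so varphi(d; x) <= 0 gives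
    d^H H(x) d <= lambda |d|^2 for d orthogonal to x.  An eigenvector of H(x)
    for an eigenvalue other than lambda is orthogonal to x, hence lambda is the
    largest eigenvalue. *)
Set Implicit Arguments.
Unset Strict Implicit.
Unset Printing Implicit Defensive.
Local Open Scope classical_set_scope.

(** * Hermitian forms and the Euclidean norm *)

Import Normc.
Section Forms.
Context {R : realType} {n : nat}.
Local Notation C := R[i].
Implicit Types (M : 'M[C]_n) (x y z d : 'cV[C]_n) (a b : R).

Lemma ctmxD k l (u v : 'M[C]_(k, l)) : (u + v)^t* = u^t* + v^t*.
Proof. by rewrite linearD /= map_mxD. Qed.

Lemma ctmxZ k l (c : C) (u : 'M[C]_(k, l)) : (c *: u)^t* = (conjc c) *: u^t*.
Proof. by rewrite linearZ /= map_mxZ. Qed.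

Lemma ctmxM k l p (u : 'M[C]_(k, l)) (v : 'M[C]_(l, p)) :
  (u *m v)^t* = v^t* *m u^t*.
Proof. by rewrite trmx_mul map_mxM. Qed.

Lemma ctmx_herm M : M \is hermsymmx -> M^t* = M.
Proof. by move/is_hermitianmxP; rewrite expr0 scale1r => <-. Qed.

Lemma ReD (c e : C) : complex.Re (c + e) = complex.Re c + complex.Re e.
Proof. by case: c e => [? ?] [? ?]. Qed.

Lemma ReZ a (c : C) : complex.Re (a%:C * c) = a * complex.Re c.
Proof. by case: c => [? ?] /=; rewrite mul0r subr0. Qed.

Lemma Re_sum (I : Type) (r : seq I) (P : pred I) (f : I -> C) :
  complex.Re (\sum_(i <- r | P i) f i) = \sum_(i <- r | P i) complex.Re (f i).
Proof. exact: (big_morph _ ReD (erefl _)). Qed.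

Lemma reformDl M y z x : reform M (y + z) x = reform M y x + reform M z x.
Proof. by rewrite /reform ctmxD !mulmxDl mxE ReD. Qed.

Lemma reformDr M y x z : reform M y (x + z) = reform M y x + reform M y z.
Proof. by rewrite /reform !mulmxDr mxE ReD. Qed.

Lemma reformZl M a y x : reform M (a%:C *: y) x = a * reform M y x.
Proof. by rewrite /reform ctmxZ conjc_real -!scalemxAl mxE ReZ. Qed.

Lemma reformZr M a y x : reform M y (a%:C *: x) = a * reform M y x.
Proof. by rewrite /reform -!scalemxAr mxE ReZ. Qed.

Lemma reformDM M N y x : reform (M + N) y x = reform M y x + reform N y x.
Proof. by rewrite /reform mulmxDr mulmxDl mxE ReD. Qed.

Lemma reformZM M a y x : reform (a%:C *: M) y x = a * reform M y x.
Proof. by rewrite /reform -!scalemxAr -!scalemxAl mxE ReZ. Qed.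

Lemma reform_sumM (I : Type) (r : seq I) (P : pred I) (f : I -> 'M[C]_n) y x :
  reform (\sum_(i <- r | P i) f i) y x = \sum_(i <- r | P i) reform (f i) y x.
Proof.
apply: (big_morph (fun M => reform M y x)); first by move=> *; rewrite reformDM.
by rewrite /reform mulmx0 mul0mx mxE.
Qed.

Lemma reform_herm M y x : M \is hermsymmx -> reform M y x = reform M x y.
Proof.
move=> /ctmx_herm HM; rewrite /reform.
have -> : y^t* *m M *m x = (x^t* *m M *m y)^t*.
  by rewrite !ctmxM trmxCK HM mulmxA.
by rewrite mxE mxE; case: ((x^t* *m M *m y) 0 0).
Qed.

Lemma reformE M y x : reform M y x =
  \sum_i \sum_j complex.Re (conjc (y i 0) * M i j * x j 0).
Proof.
rewrite /reform !mxE Re_sum exchange_big /=; apply: eq_bigr => j _.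
by rewrite !mxE mulr_suml Re_sum; apply: eq_bigr => i _; rewrite !mxE.
Qed.

Lemma enorm_ge0 x : 0 <= enorm x.
Proof. exact: sqrtr_ge0. Qed.

Lemma enorm_sqr x : enorm x ^+ 2 = qform 1%:M x.
Proof.
rewrite sqr_sqrtr; last by apply: sumr_ge0 => j _; rewrite addr_ge0 ?sqr_ge0.
rewrite /qform /reform mulmx1 mxE Re_sum; apply: eq_bigr => j _; rewrite !mxE.
by case: (x j 0) => a b /=; rewrite mulNr opprK -!expr2.
Qed.

Lemma enorm_eq0 x : (enorm x == 0) = (x == 0).
Proof.
apply/idP/eqP => [|->]; last first.
  by rewrite /enorm big1 ?sqrtr0 // => j _; rewrite mxE /= expr0n addr0.
rewrite -sqrf_eq0 sqr_sqrtr; last first.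
  by apply: sumr_ge0 => j _; rewrite addr_ge0 ?sqr_ge0.
rewrite psumr_eq0 => [/allP x0|j _]; last by rewrite addr_ge0 ?sqr_ge0.
apply/colP => j; have := x0 j; rewrite mem_index_enum => /(_ isT) /=.
rewrite paddr_eq0 ?sqr_ge0// !sqrf_eq0 !mxE.
by case: (x j 0) => a b /= /andP[/eqP -> /eqP ->].
Qed.

Lemma enormZ a x : enorm (a%:C *: x) = `|a| * enorm x.
Proof.
apply/eqP; rewrite -(@eqrXn2 _ 2) ?mulr_ge0 ?enorm_ge0//; apply/eqP.
by rewrite exprMn !enorm_sqr /qform reformZl reformZr mulrA -expr2 real_normK ?num_real.
Qed.

Lemma normc_le_enorm x j : normc (x j 0) <= enorm x.
Proof.
rewrite /enorm /normc; case E : (x j 0) => [a b].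
apply: ler_wsqrtr; rewrite (bigD1 j)//= E/= lerDl.
by apply: sumr_ge0 => k _; rewrite addr_ge0 ?sqr_ge0.
Qed.

Lemma Re_le_normc (c : C) : `|complex.Re c| <= normc c.
Proof.
case: c => a b; rewrite /normc/= -sqrtr_sqr; apply: ler_wsqrtr.
by rewrite lerDl sqr_ge0.
Qed.

Lemma normc_conjc (c : C) : normc (conjc c) = normc c.
Proof. by case: c => a b; rewrite /normc/= sqrrN. Qed.

(** Boundedness of a sesquilinear form, with the sum of the moduli of the
    entries of the matrix as constant. *)
Lemma reform_bounded M : exists2 K : R, 0 <= K &
  forall y x, `|reform M y x| <= K * (enorm y * enorm x).
Proof.
exists (\sum_i \sum_j normc (M i j)).
  by apply: sumr_ge0 => i _; apply: sumr_ge0 => j _; case: (M i j) => a b; apply: sqrtr_ge0.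
move=> y x; rewrite reformE mulr_suml.
apply: le_trans (ler_norm_sum _ _ _) _; apply: ler_sum => i _.
rewrite mulr_suml; apply: le_trans (ler_norm_sum _ _ _) _; apply: ler_sum => j _.
apply: le_trans (Re_le_normc _) _; rewrite !normcM normc_conjc mulrAC mulrC.
have N0 (c : C) : 0 <= normc c by case: c => *; apply: sqrtr_ge0.
by rewrite ler_wpM2l// ler_pM ?normc_le_enorm.
Qed.

End Forms.

(** * Second-order Taylor expansion of an antiderivative *)

(** First-order expansion with Peano remainder: the definition of the
    derivative, with the division cleared. *)
Lemma derivable_peano (R : realType) (h : R -> R) (a e : R) : 0 < e ->
  derivable h a 1 -> exists2 delta : R, 0 < delta & forall s, `|s| <= delta ->
    `|h (a + s) - h a - derive1 h a * s| <= e * `|s|.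
Proof.
move=> e0 dh.
have : (fun s => s^-1 * (h (s + a) - h a)) @ 0^' --> derive1 h a.
  have := dh; rewrite /derivable derive1E /derive.
  by under eq_fun do rewrite scaler1; move=> cv; exact: cv.
move=> /cvgrPdist_le /(_ e e0) /nbhs_ballP [r /= r0 B].
exists (r / 2); first by rewrite divr_gt0.
move=> s sr; have [->|s0] := eqVneq s 0.
  by rewrite addr0 subrr mulr0 subr0 normr0 mulr0.
have sr' : ball 0 r s by rewrite /ball/= sub0r normrN; lra.
have /= := B s sr' s0; rewrite -(ler_pM2r (_ : 0 < `|s|)) ?normr_gt0// -normrM.
suff -> : h (a + s) - h a - derive1 h a * s = - ((derive1 h a - s^-1 * (h (s + a) - h a)) * s).
  by rewrite normrN.
by rewrite (addrC s a); field.
Qed.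

(** The derivative of the remainder at a + u is the first-order remainder of h,
    bounded by e |u|; the mean value theorem integrates this bound. *)
Lemma antiderivative_taylor2 (R : realType) (phi h : R -> R) (a e : R) : 0 < e ->
  (forall t : R, is_derive t 1 phi (h t)) -> derivable h a 1 ->
  exists2 delta : R, 0 < delta & forall s, `|s| <= delta ->
    `|phi (a + s) - phi a - h a * s - derive1 h a / 2 * s ^+ 2| <= e * s ^+ 2.
Proof.
move=> e0 dphi /(derivable_peano e0)[delta delta0 P]; exists delta => // s sd.
pose g t := phi t - h a * t - derive1 h a / 2 * (t - a) ^+ 2.
pose dg t := h t - h a - derive1 h a * (t - a).
have Dg (t : R) : is_derive t 1 g (dg t).
  have -> : g = phi - h a *: (@id R) - (derive1 h a / 2) *: ((@id R - cst a) ^+ 2).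
    by apply/funext => u; rewrite /g /= !fctE.
  have := dphi t => ?; apply: is_derive_eq.
  rewrite /dg /= !fctE /GRing.scale/=; by field.
have Cg : continuous g.
  move=> t; apply: differentiable_continuous; apply/derivable1_diffP.
  exact: ex_derive.
have dgP t : `|t - a| <= `|s| -> `|dg t| <= e * `|s|.
  move=> ts; have := P _ (le_trans ts sd); rewrite (addrC a) subrK => /le_trans.
  by apply; rewrite ler_pM2l.
have -> : phi (a + s) - phi a - h a * s - derive1 h a / 2 * s ^+ 2 = g (a + s) - g a.
  by rewrite /g; ring.
suff [c cs ->] : exists2 c, `|c - a| <= `|s| & g (a + s) - g a = dg c * s.
  rewrite normrM -real_normK ?num_real// expr2 mulrA.
  by rewrite ler_wpM2r// dgP.
have [s0|s0] := leP 0 s.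
  have [] := @MVT_segment R g dg a (a + s) _ (fun t _ => Dg t).
  - by rewrite lerDl.
  - exact: continuous_subspaceT.
  move=> c; rewrite in_itv /= => /andP[c1 c2] E; exists c.
    by rewrite !ger0_norm; lra.
  by rewrite E; congr (_ * _); ring.
have [] := @MVT_segment R g dg (a + s) a _ (fun t _ => Dg t).
- by lra.
- exact: continuous_subspaceT.
move=> c; rewrite in_itv /= => /andP[c1 c2] E; exists c.
  by rewrite !ler0_norm; lra.
by rewrite -opprB E; ring.
Qed.

(** The next three lemmas are about real numbers only.  There l stands for |d|,
    q0 for q(x), q for q(d), r for Re (d^H M x), and s for the displacement of
    the form from x to the normalized vector x + d; K is a bound of the form. *)
Lemma norm_displacement_le (R : realType) (K q0 q r l s : R) :
  0 <= K -> 0 <= l -> l <= 1 -> `|q0| <= K -> `|q| <= K * l ^+ 2 -> `|r| <= K * l ->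
  s * (1 + l ^+ 2) = 2 * r + q - l ^+ 2 * q0 -> `|s| <= 4 * (K * l).
Proof.
move=> K0 l0 l1 q0K qK rK sE.
have l2 : 0 <= l ^+ 2 by exact: sqr_ge0.
have Kl2' : K * l ^+ 2 <= K * l by rewrite ler_wpM2l// expr2 ler_piMr.
have q0l : `|l ^+ 2 * q0| <= K * l ^+ 2.
  by rewrite normrM (ger0_norm l2) mulrC ler_wpM2r.
have : `|s| <= `|s * (1 + l ^+ 2)|.
  by rewrite normrM ler_peMr // ger0_norm; lra.
move=> /le_trans; apply; rewrite sE.
apply: le_trans (ler_normB _ _) _; apply: le_trans (lerD (ler_normD _ _) (lexx _)) _.
rewrite normrM (ger0_norm (_ : 0 <= 2)) //; lra.
Qed.

(** Replacing s by 2 r + q - l^2 q0 in the linear term, and by 2 r in the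
    quadratic term, costs O(l^3).  Here c1 and c2 stand for h(q0) and h'(q0), and
    err for the Taylor remainder at q0 + s. *)
Lemma remainder_bound (R : realType) (K e' q0 q r l s c1 c2 err : R) :
  0 <= K -> 0 <= l -> l <= 1 -> `|q0| <= K -> `|q| <= K * l ^+ 2 -> `|r| <= K * l ->
  s * (1 + l ^+ 2) = 2 * r + q - l ^+ 2 * q0 ->
  `|err| <= e' * s ^+ 2 ->
  0 <= e' ->
  `|c1 * s + c2 / 2 * s ^+ 2 + err - (c1 * (2 * r + q - l ^+ 2 * q0) + 2 * c2 * r ^+ 2)|
  <= (16 * K ^+ 2 * e' + (4 * `|c1| * K + 18 * `|c2| * K ^+ 2) * l) * l ^+ 2.
Proof.
move=> K0 l0 l1 q0K qK rK sE errE e'0.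
have l2 : 0 <= l ^+ 2 by exact: sqr_ge0.
have Kl : 0 <= K * l by apply: mulr_ge0.
have Kl2 : 0 <= K * l ^+ 2 by apply: mulr_ge0.
have Kl2' : K * l ^+ 2 <= K * l by rewrite ler_wpM2l// expr2 ler_piMr.
have q0l : `|l ^+ 2 * q0| <= K * l ^+ 2.
  by rewrite normrM (ger0_norm l2) mulrC ler_wpM2r.
have sK := norm_displacement_le K0 l0 l1 q0K qK rK sE.
have s2K : s ^+ 2 <= 16 * K ^+ 2 * l ^+ 2.
  rewrite -(real_normK (num_real s)).
  have -> : 16 * K ^+ 2 * l ^+ 2 = (4 * (K * l)) ^+ 2 by ring.
  by rewrite ler_pXn2r ?nnegrE ?mulr_ge0.
(* w = s - 2 r is the second-order part of the displacement. *)
pose w := q - l ^+ 2 * q0 - s * l ^+ 2.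
have wK : `|w| <= 6 * (K * l ^+ 2).
  have sl : `|s * l ^+ 2| <= 4 * (K * l ^+ 2).
    rewrite normrM (ger0_norm l2); apply: le_trans (ler_wpM2r l2 sK) _.
    have -> : 4 * (K * l) * l ^+ 2 = 4 * (K * l ^+ 2) * l by ring.
    by rewrite ler_piMr // mulr_ge0.
  apply: le_trans (ler_normB _ _) _; apply: le_trans (lerD (ler_normB _ _) (lexx _)) _.
  lra.
have sw : s = 2 * r + w by rewrite /w; lra.
have s2r : `|s + 2 * r| <= 6 * (K * l).
  apply: le_trans (ler_normD _ _) _; rewrite normrM (ger0_norm (_ : 0 <= 2)) //; lra.
have -> : c1 * s + c2 / 2 * s ^+ 2 + err -
    (c1 * (2 * r + q - l ^+ 2 * q0) + 2 * c2 * r ^+ 2) =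
    err - c1 * s * l ^+ 2 + c2 / 2 * (w * (s + 2 * r)).
  rewrite -sE (_ : w = s - 2 * r); last by lra.
  by field.
have b1 : `|err| <= 16 * K ^+ 2 * e' * l ^+ 2.
  apply: le_trans errE _; apply: le_trans (ler_wpM2l e'0 s2K) _.
  by rewrite le_eqVlt; apply/orP; left; apply/eqP; ring.
have b2 : `|c1 * s * l ^+ 2| <= 4 * `|c1| * K * l * l ^+ 2.
  rewrite normrM (ger0_norm l2) ler_wpM2r// normrM.
  have -> : 4 * `|c1| * K * l = `|c1| * (4 * (K * l)) by ring.
  by rewrite ler_wpM2l.
have b3 : `|c2 / 2 * (w * (s + 2 * r))| <= 18 * `|c2| * K ^+ 2 * l * l ^+ 2.
  rewrite normrM (normrM c2) (normrM w) (ger0_norm (_ : 0 <= 2^-1))//.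
  have -> : 18 * `|c2| * K ^+ 2 * l * l ^+ 2 =
    `|c2| / 2 * (6 * (K * l ^+ 2) * (6 * (K * l))) by field.
  by rewrite ler_wpM2l ?divr_ge0// ler_pM.
apply: le_trans (ler_normD _ _) _; apply: le_trans (lerD (ler_normB _ _) (lexx _)) _.
by apply: le_trans (lerD (lerD b1 b2) b3) _; rewrite le_eqVlt; apply/orP; left; apply/eqP; ring.
Qed.

(** Expansion of phi at the displaced value p of the form, up to o(l^2),
    uniformly in the data q and r. *)
Lemma composite_expansion (R : realType) (phi h : R -> R) (K q0 e : R) :
  0 <= K -> `|q0| <= K -> 0 < e ->
  (forall t : R, is_derive t 1 phi (h t)) -> derivable h q0 1 ->
  exists2 delta : R, 0 < delta & forall l p q r : R, 0 <= l -> l <= delta ->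
    `|q| <= K * l ^+ 2 -> `|r| <= K * l -> p * (1 + l ^+ 2) = q0 + 2 * r + q ->
  `|phi p - phi q0 - (h q0 * (2 * r + (q - l ^+ 2 * q0))
       + 2 * (derive1 h q0 * r ^+ 2))| <= e * l ^+ 2.
Proof.
move=> K0 q0K e0 dphi dh.
have K1 : 0 < 16 * K ^+ 2 + 1 by have := sqr_ge0 K; lra.
(* The Taylor remainder, at most e' s^2 with |s| <= 4 K l, and the cubic terms
   of the substitution each receive half of e. *)
pose e' := e / 2 / (16 * K ^+ 2 + 1).
have e'0 : 0 < e' by rewrite !divr_gt0.
have [delta0 delta00] := antiderivative_taylor2 e'0 dphi dh.
move: (h q0) (derive1 h q0) => c1 c2 Pphi.
pose B := 4 * `|c1| * K + 18 * `|c2| * K ^+ 2.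
have B0 : 0 <= B by rewrite addr_ge0 ?mulr_ge0 ?sqr_ge0.
have K41 : 0 < 4 * K + 1 by lra.
have B1 : 0 < B + 1 by lra.
exists (Num.min 1 (Num.min (delta0 / (4 * K + 1)) (e / 2 / (B + 1)))).
  by rewrite !lt_min ltr01 !divr_gt0.
move=> l p q r l0; rewrite !le_min => /and3P[d1 d2 d3] qK rK pE.
pose s := p - q0.
have sE : s * (1 + l ^+ 2) = 2 * r + q - l ^+ 2 * q0.
  by rewrite mulrBl pE; ring.
have sd : `|s| <= delta0.
  have s4 := norm_displacement_le K0 l0 d1 q0K qK rK sE.
  by move: d2; rewrite ler_pdivlMr//; lra.
have := Pphi s sd; set err := (X in `|X|) => errP.
have := @remainder_bound R K e' q0 q r l s c1 c2 err K0 l0 d1 q0K qK rK sE errP (ltW e'0).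
have -> : c1 * s + c2 / 2 * s ^+ 2 + err = phi p - phi q0.
  by rewrite /err /s (addrC q0) subrK; move: (phi p) (phi q0) => u v; ring.
have -> : c1 * (2 * r + q - l ^+ 2 * q0) + 2 * c2 * r ^+ 2
  = c1 * (2 * r + (q - l ^+ 2 * q0)) + 2 * (c2 * r ^+ 2) by ring.
move=> /le_trans; apply; apply: ler_wpM2r; first exact: sqr_ge0.
have t1 : 16 * K ^+ 2 * e' <= e / 2.
  rewrite /e' mulrCA ger_pMr ?divr_gt0// ler_pdivrMr//; lra.
have t2 : B * l <= e / 2.
  by move: d3; rewrite ler_pdivlMr//; lra.
rewrite -/B; lra.
Qed.

(** * Second-order expansion of the objective on the sphere *)

Section Expansion.
Context {R : realType} {n : nat}.
Local Notation C := R[i].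
Context (x : 'cV[C]_n) (x_unit : enorm x = 1).
Implicit Types (M : 'M[C]_n) (d : 'cV[C]_n).

Lemma reform1_orthogonal d : orthogonal_to d x -> reform 1%:M d x = 0.
Proof. by move=> dx; rewrite /reform mulmx1 dx mxE. Qed.

Lemma hermsymmx1 : (1%:M : 'M[C]_n) \is hermsymmx.
Proof. exact: hermitian1mx_subproof. Qed.

Lemma enorm_sqrD d : orthogonal_to d x -> enorm (x + d) ^+ 2 = 1 + enorm d ^+ 2.
Proof.
move=> dx; rewrite !enorm_sqr /qform reformDl !reformDr (reform_herm x d hermsymmx1).
have xx : reform 1%:M x x = 1 by rewrite -[LHS]enorm_sqr x_unit expr1n.
by rewrite (reform1_orthogonal dx) xx addr0 add0r.
Qed.

Lemma qform_normalize M d : M \is hermsymmx -> orthogonal_to d x ->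
  qform M (normalize (x + d)) * (1 + enorm d ^+ 2) =
  qform M x + 2 * reform M d x + qform M d.
Proof.
move=> HM dx; rewrite /normalize /qform reformZl reformZr -enorm_sqrD//.
have n0 : enorm (x + d) != 0.
  rewrite -sqrf_eq0 enorm_sqrD// gt_eqF//.
  by have := sqr_ge0 (enorm d); lra.
rewrite reformDl !reformDr (reform_herm x d HM).
move: (enorm _) n0 (reform M x x) (reform M d x) (reform M d d) => a a0 p q r.
by field.
Qed.

(** The contribution of one matrix to the expansion of the objective. *)
Lemma term_expansion M (phi h : R -> R) (e : R) : M \is hermsymmx -> 0 < e ->
  (forall t : R, is_derive t 1 phi (h t)) -> (forall t, derivable h t 1) ->
  exists2 delta : R, 0 < delta & forall d, orthogonal_to d x -> enorm d <= delta ->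
  `|phi (qform M (normalize (x + d))) - phi (qform M x)
    - (h (qform M x) * (2 * reform M d x + (qform M d - enorm d ^+ 2 * qform M x))
       + 2 * (derive1 h (qform M x) * reform M d x ^+ 2))| <= e * enorm d ^+ 2.
Proof.
move=> HM e0 dphi dh; have [K K0 MK] := reform_bounded M.
have q0K : `|qform M x| <= K by have := MK x x; rewrite x_unit !mulr1.
have [delta delta0 P] := composite_expansion K0 q0K e0 dphi (dh _).
exists delta => // d dx dd; apply: P (enorm_ge0 d) dd _ _ (qform_normalize HM dx).
  by have := MK d d; rewrite -expr2.
by have := MK d x; rewrite x_unit mulr1.
Qed.

End Expansion.

(** Finitely many properties, each valid below some radius, have a common one. *)
Lemma common_radius (R : realType) m (P : 'I_m -> R -> Prop) :
  (forall i r s, r <= s -> P i s -> P i r) ->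
  (forall i, exists2 r, 0 < r & P i r) -> exists2 r, 0 < r & forall i, P i r.
Proof.
move=> Pmono Pex.
have : \forall r \near (0 : R)^'+, forall i, P i r.
  apply: filter_forall => i; have [s s0 Ps] := Pex i; near=> r.
  by apply: Pmono Ps; near: r; exact: nbhs_right_le.
move=> PF; near (0 : R)^'+ => r; exists r; first by near: r; exact: nbhs_right_gt.
by near: r.
Unshelve. all: by end_near. Qed.

Section Varphi.
Context {R : realType} {m n : nat}.
Local Notation C := R[i].
Context (A : 'I_m -> 'M[C]_n) (h phi : 'I_m -> R -> R) (x : 'cV[C]_n).
Implicit Types (d : 'cV[C]_n).

Lemma reform_Hmx y z : reform (Hmx A h x) y z =
  \sum_i h i (qform (A i) x) * reform (A i) y z.
Proof. by rewrite reform_sumM; apply: eq_bigr => i _; rewrite reformZM. Qed.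

Lemma qform_shift (M : 'M[C]_n) (a : R) d :
  qform (M - a%:C%:M) d = qform M d - a * enorm d ^+ 2.
Proof.
have -> : a%:C%:M = a%:C *: 1%:M :> 'M[C]_n by rewrite scalemx1.
have -> : - (a%:C *: 1%:M) = (- a)%:C *: 1%:M :> 'M[C]_n by rewrite -scaleNr rmorphN.
by rewrite enorm_sqr /qform reformDM reformZM mulNr.
Qed.

Lemma varphiE d : varphi A h d x =
  \sum_i (h i (qform (A i) x) * (qform (A i) d - enorm d ^+ 2 * qform (A i) x)
    + 2 * (derive1 (h i) (qform (A i) x) * reform (A i) d x ^+ 2)).
Proof.
rewrite /varphi qform_shift /qform !reform_Hmx big_split /= -mulr_sumr; congr (_ + _).
by rewrite mulr_suml -sumrB; apply: eq_bigr => i _; ring.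
Qed.

Lemma varphiZ a d : varphi A h (a%:C *: d) x = a ^+ 2 * varphi A h d x.
Proof.
rewrite !varphiE mulr_sumr; apply: eq_bigr => i _.
rewrite enormZ exprMn real_normK ?num_real// /qform !reformZl reformZr.
move: (reform (A i) d d) (reform (A i) d x) (reform (A i) x x) => q r q0.
by move: (h i q0) (derive1 _ _) (enorm d) => u v l; ring.
Qed.

(** The second-order expansion of the objective at x, tangentially to the sphere. *)
Lemma Fobj_expansion (e : R) : enorm x = 1 -> (forall i, A i \is hermsymmx) ->
  (forall i (t : R), derivable (h i) t 1) ->
  (forall i (t : R), is_derive t 1 (phi i) (h i t)) -> 0 < e ->
  exists2 delta : R, 0 < delta & forall d, orthogonal_to d x -> enorm d <= delta ->
  `|Fobj A phi (normalize (x + d)) - Fobj A phi x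
    - (2 * reform (Hmx A h x) d x + varphi A h d x)| <= e * enorm d ^+ 2.
Proof.
move=> x1 HA dh dphi e0.
(* m.+1 rather than m, which may be 0 *)
have e'0 : 0 < e / m.+1%:R by rewrite divr_gt0.
have [|i|delta delta0 Pd] := @common_radius R m (fun i r => forall d,
    orthogonal_to d x -> enorm d <= r ->
    `|phi i (qform (A i) (normalize (x + d))) - phi i (qform (A i) x)
    - (h i (qform (A i) x) * (2 * reform (A i) d x + (qform (A i) d - enorm d ^+ 2 * qform (A i) x))
       + 2 * (derive1 (h i) (qform (A i) x) * reform (A i) d x ^+ 2))|
    <= e / m.+1%:R * enorm d ^+ 2).
- by move=> i r s rs Ps d dx /le_trans -/(_ _ rs); exact: Ps.
- exact: (term_expansion x1 (HA i) e'0 (dphi i) (dh i)).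
exists delta => // d dx dd.
rewrite reform_Hmx varphiE mulr_sumr -big_split -!sumrB /=.
apply: le_trans (ler_norm_sum _ _ _) _.
apply: (@le_trans _ _ (\sum_(i < m) e / m.+1%:R * enorm d ^+ 2)).
  apply: ler_sum => i _; apply: le_trans (Pd i d dx dd).
  by rewrite addrA [2 * (_ * reform _ _ _)]mulrCA -mulrDr.
rewrite sumr_const card_ord -[leLHS]mulr_natr mulrAC ler_wpM2r ?sqr_ge0//.
by rewrite -mulrA ger_pMr// mulrC ler_pdivrMr// mul1r ler_nat.
Qed.

End Varphi.

(** * Uniform negativity of a negative definite form *)

Lemma continuous_reform (R : realType) (T : topologicalType) n
    (M : 'M[R[i]]_n) (f g : T -> 'cV[R[i]]_n) :
  (forall i, continuous (fun t => complex.Re (f t i 0))) ->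
  (forall i, continuous (fun t => complex.Im (f t i 0))) ->
  (forall i, continuous (fun t => complex.Re (g t i 0))) ->
  (forall i, continuous (fun t => complex.Im (g t i 0))) ->
  continuous (fun t => reform M (f t) (g t)).
Proof.
move=> cfr cfi cgr cgi; under eq_fun do rewrite reformE.
apply: continuous_big => [|i _]; first exact: add_continuous.
apply: continuous_big => [|j _]; first exact: add_continuous.
have E t : complex.Re (conjc (f t i 0) * M i j * g t j 0) =
    complex.Re (M i j) * (complex.Re (f t i 0) * complex.Re (g t j 0) +
                          complex.Im (f t i 0) * complex.Im (g t j 0))
    - complex.Im (M i j) * (complex.Re (f t i 0) * complex.Im (g t j 0) -
                            complex.Im (f t i 0) * complex.Re (g t j 0)).
  by case: (f t i 0) (M i j) (g t j 0) => [? ?] [? ?] [? ?] /=; ring.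
under eq_fun do rewrite E.
move=> v; apply: (@continuousB _ _ _ (fun w => complex.Re (M i j) * _)
    (fun w => complex.Im (M i j) * _));
  apply: continuousM; (try exact: cst_continuous).
  apply: continuousD; apply: continuousM;
    [exact: cfr|exact: cgr|exact: cfi|exact: cgi].
apply: continuousB; apply: continuousM;
  [exact: cfr|exact: cgi|exact: cfi|exact: cgr].
Qed.

Section Coercivity.
Context {R : realType} {n : nat}.
Local Notation C := R[i].

(** The identification of R^(2n) with C^n: real parts in the first block,
    imaginary parts in the second.  Compactness is used in R^(2n). *)
Definition of_reals (v : 'rV[R]_(n + n)) : 'cV[C]_n :=
  \col_j (v 0 (lshift n j) +i* v 0 (rshift n j)).

(** The inverse of [of_reals]. *)
Definition to_reals (d : 'cV[C]_n) : 'rV[R]_(n + n) :=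
  row_mx (\row_j complex.Re (d j 0)) (\row_j complex.Im (d j 0)).

Lemma to_realsK : cancel to_reals of_reals.
Proof.
move=> d; apply/colP => j; rewrite /of_reals /to_reals mxE row_mxEl row_mxEr !mxE.
by case: (d j 0).
Qed.

Lemma continuous_Re_of_reals i :
  continuous (fun v : 'rV[R]_(n + n) => complex.Re (of_reals v i 0)).
Proof. by under eq_fun do rewrite mxE/=; exact: coord_continuous. Qed.

Lemma continuous_Im_of_reals i :
  continuous (fun v : 'rV[R]_(n + n) => complex.Im (of_reals v i 0)).
Proof. by under eq_fun do rewrite mxE/=; exact: coord_continuous. Qed.

Lemma continuous_qform_of_reals (M : 'M[C]_n) :
  continuous (fun v => qform M (of_reals v)).
Proof.
by apply: continuous_reform; do ?[exact: continuous_Re_of_reals|exact: continuous_Im_of_reals].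
Qed.

Lemma continuous_reform_of_reals (M : 'M[C]_n) (x : 'cV[C]_n) :
  continuous (fun v => reform M (of_reals v) x).
Proof.
apply: continuous_reform; do ?[exact: continuous_Re_of_reals|exact: continuous_Im_of_reals];
  by move=> i; exact: cst_continuous.
Qed.

(** The two forms are the real part of d^H x and minus its imaginary part. *)
Lemma orthogonal_toP (d x : 'cV[C]_n) :
  orthogonal_to d x <-> reform 1%:M d x = 0 /\ reform ('i)%C%:M d x = 0.
Proof.
rewrite /orthogonal_to /reform mulmx1 mul_mx_scalar -scalemxAl [X in _ /\ complex.Re X = _]mxE.
split; first by move=> ->; rewrite !mxE mulr0.
move=> [re0 im0]; apply/matrixP => i j; rewrite !ord1 [RHS]mxE.
move: re0 im0; case: ((d^t* *m x) 0 0) => a b /= -> /=.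
by rewrite mul1r mul0r sub0r => /eqP; rewrite oppr_eq0 => /eqP ->.
Qed.

(** The norm on the left is the max norm of row vectors. *)
Lemma norm_le_enorm_of_reals (v : 'rV[R]_(n + n)) : `|v| <= enorm (of_reals v).
Proof.
have H k : (v 0 k) ^+ 2 <= enorm (of_reals v) ^+ 2.
  rewrite sqr_sqrtr; last by apply: sumr_ge0 => j _; rewrite addr_ge0 ?sqr_ge0.
  have S (j : 'I_n) : v 0 (lshift n j) ^+ 2 + v 0 (rshift n j) ^+ 2 <=
      \sum_(j < n) (complex.Re (of_reals v j 0) ^+ 2 + complex.Im (of_reals v j 0) ^+ 2).
    rewrite (bigD1 j)//= mxE/= lerDl.
    by apply: sumr_ge0 => i _; rewrite addr_ge0 ?sqr_ge0.
  case: (split_ordP k) => j ->; apply: le_trans (S j).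
    by rewrite lerDl sqr_ge0.
  by rewrite lerDr sqr_ge0.
rewrite /Num.norm /= mx_normrE; apply: bigmax_le; first exact: enorm_ge0.
move=> [i k] _ /=; rewrite ord1.
by rewrite -ler_sqr ?nnegrE ?enorm_ge0// real_normK ?num_real.
Qed.

(** A continuous real quadratic function that is negative on the nonzero vectors
    orthogonal to x is at most - c |d|^2 there: it attains its maximum on the unit
    sphere of that space. *)
Lemma coercive_quadratic (Q : 'cV[C]_n -> R) (x : 'cV[C]_n) :
  continuous (Q \o of_reals) -> (forall a d, Q (a%:C *: d) = a ^+ 2 * Q d) ->
  (forall d, d != 0 -> orthogonal_to d x -> Q d < 0) ->
  exists2 c, 0 < c & forall d, orthogonal_to d x -> Q d <= - c * enorm d ^+ 2.
Proof.
move=> Qc QZ Qneg.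
pose S := [set v | qform 1%:M (of_reals v) = 1] `&`
  ([set v | reform 1%:M (of_reals v) x = 0] `&`
   [set v | reform ('i)%C%:M (of_reals v) x = 0]).
have level_closed (f : 'rV[R]_(n + n) -> R) a : continuous f -> closed [set v | f v = a].
  move=> cf; apply: (@preimage_closed _ _ f [set r | r = a]) => [v _|]; first exact: cf.
  exact: (@closed_eq _ a).
have Sclosed : closed S.
  apply: closedI; first exact/level_closed/continuous_qform_of_reals.
  by apply: closedI; exact/level_closed/continuous_reform_of_reals.
have SP v : S v -> enorm (of_reals v) = 1 /\ orthogonal_to (of_reals v) x.
  move=> [v1 [v2 v3]]; split; last exact/orthogonal_toP.
  by apply/eqP; rewrite -(@pexpr_eq1 _ _ 2) ?enorm_ge0// enorm_sqr v1.
have Sbounded : bounded_set S.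
  exists 1; split=> [|b b1 v /SP[v1 _] /=]; first exact: num_real.
  by apply: le_trans (ltW b1); rewrite -v1; exact: norm_le_enorm_of_reals.
have Scompact := bounded_closed_compact Sbounded Sclosed.
have [c c0 cS] : exists2 c, 0 < c & forall v, S v -> Q (of_reals v) <= - c.
  (* The sphere is empty when x spans the space; any c then works. *)
  have [S0|S0] := pselect (S !=set0); last first.
    by exists 1 => // v Sv; case: S0; exists v.
  have [w wS wmax] := compact_EVT_max S0 Scompact (continuous_subspaceT Qc).
  move/set_mem/SP : wS => [w1 w2].
  exists (- Q (of_reals w)); last by move=> v /mem_set /wmax; rewrite opprK.
  by rewrite oppr_gt0; apply: Qneg => //; rewrite -enorm_eq0 w1; exact: oner_neq0.
exists c => // d dx; have [->|d0] := eqVneq d 0.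
  have := QZ 0 0; rewrite scaler0 expr0n mul0r => ->.
  by rewrite (_ : enorm 0 = 0) ?expr0n ?mulr0//; apply/eqP; rewrite enorm_eq0.
have nd0 : enorm d != 0 by rewrite enorm_eq0.
have dE : d = (enorm d)%:C *: of_reals (to_reals (normalize d)).
  by rewrite to_realsK /normalize scalerA -rmorphM/= divff// scale1r.
rewrite {1}dE QZ mulrC ler_wpM2r ?sqr_ge0//; apply: cS.
rewrite /S/= to_realsK -enorm_sqr; split.
  by rewrite /normalize enormZ ger0_norm ?invr_ge0 ?enorm_ge0// mulVf// expr1n.
by have [d1 d2] := (orthogonal_toP d x).1 dx; rewrite /normalize !reformZl d1 d2 mulr0.
Qed.

End Coercivity.

(** * Eigenvectors of Hermitian matrices and optimality conditions *)

(** Necessary conditions for t = 0 to be a local maximum of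
    2 t rho + t^2 p + o(t^2). *)
Lemma nonpos_quadratic (R : realType) (rho p : R) :
  (forall e, 0 < e -> exists2 delta, 0 < delta & forall t, `|t| <= delta ->
     2 * (t * rho) + t ^+ 2 * p <= e * t ^+ 2) -> rho = 0 /\ p <= 0.
Proof.
move=> H; have rho0 : rho = 0.
  apply/eqP; apply/negPn/negP => rho0.
  have [delta delta0 P] := H 1 ltr01.
  have p1 : 0 < 1 + `|p| by rewrite ltr_pwDl.
  have nr : 0 < `|rho| by rewrite normr_gt0.
  (* At t = c rho the condition reads 2 + c p <= c, false for small c. *)
  pose c := Num.min (delta / `|rho|) (1 + `|p|)^-1.
  have c0 : 0 < c by rewrite lt_min divr_gt0//= invr_gt0.
  have c1 : c * (1 + `|p|) <= 1 by rewrite -ler_pdivlMr// div1r /c ge_min lexx orbT.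
  have := P (c * rho); rewrite normrM (gtr0_norm c0) -ler_pdivlMr// /c ge_min lexx /=.
  rewrite -/c => /(_ isT).
  have r2 : 0 < c * rho ^+ 2 by rewrite mulr_gt0// exprn_even_gt0.
  have -> : 2 * (c * rho * rho) + (c * rho) ^+ 2 * p = (c * rho ^+ 2) * (2 + c * p) by ring.
  have -> : 1 * (c * rho) ^+ 2 = (c * rho ^+ 2) * c by ring.
  rewrite ler_pM2l//.
  have : - (c * `|p|) <= c * p by rewrite -mulrN ler_pM2l// lerNnormlW.
  lra.
split=> //; apply/ler_addgt0Pr => e e0; rewrite add0r.
have [delta delta0 P] := H e e0.
have := P delta; rewrite gtr0_norm// rho0 !mulr0 add0r mulrC => /(_ (lexx _)).
by rewrite ler_pM2r// exprn_gt0.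
Qed.

Lemma continuous_varphi (R : realType) m n (A : 'I_m -> 'M[R[i]]_n) (h : 'I_m -> R -> R) x :
  continuous ((fun d => varphi A h d x) \o of_reals).
Proof.
rewrite /comp /varphi => v.
apply: (@continuousD _ _ _ (fun v => qform _ (of_reals v)) (fun v => 2 * _)).
  exact: continuous_qform_of_reals.
apply: continuousM; first exact: cst_continuous.
apply: continuous_big => [|i _ w]; first exact: add_continuous.
apply: (@continuousM _ _ (fun=> _) (fun v => reform _ _ _ ^+ 2)); first exact: cst_continuous.
by apply: (@continuousM _ _ (fun v => reform _ _ _) (fun v => reform _ _ _));
  exact: continuous_reform_of_reals.
Qed.

Lemma nondecreasing_derive1_ge0 (R : realType) (h : R -> R) (t : R) :
  {homo h : s u / s <= u} -> derivable h t 1 -> 0 <= derive1 h t.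
Proof.
move=> hmono dh; apply/ler_addgt0Pr => e e0.
have [delta delta0 P] := derivable_peano e0 dh.
have := P delta; rewrite gtr0_norm// => /(_ (lexx _)); rewrite ler_norml => /andP[_].
have : h t <= h (t + delta) by apply: hmono; rewrite lerDl ltW.
move: (h t) (h (t + delta)) (derive1 h t) => u v w uv.
move=> H; rewrite -(pmulr_lge0 _ delta0); lra.
Qed.

Section Optimality.
Context {R : realType} {m n : nat}.
Local Notation C := R[i].
Context (A : 'I_m -> 'M[C]_n) (h phi : 'I_m -> R -> R).
Context (A_herm : forall i, A i \is hermsymmx).
Implicit Types (M : 'M[C]_n) (x y d : 'cV[C]_n).

Lemma Hmx_herm x : Hmx A h x \is hermsymmx.
Proof.
apply/is_hermitianmxP; rewrite expr0 scale1r /Hmx raddf_sum /= raddf_sum/=.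
apply: eq_bigr => i _.
by rewrite ctmxZ conjc_real ctmx_herm.
Qed.

(** The form x^H M x of a Hermitian matrix is real. *)
Lemma herm_form_real M x : M \is hermsymmx -> x^t* *m M *m x = (qform M x)%:C%:M.
Proof.
move=> HM; have HH : (x^t* *m M *m x)^t* = x^t* *m M *m x.
  by rewrite !ctmxM trmxCK (ctmx_herm HM) mulmxA.
apply/matrixP => i j; rewrite !ord1 [RHS]mxE eqxx mulr1n /qform /reform.
have := congr1 (fun B : 'M[C]_1 => complex.Im (B 0 0)) HH; rewrite !mxE.
move: (\sum_ _ _) => c; case: c => a b /= bE; congr (_ +i* _).
move: bE => /=; lra.
Qed.

Lemma orthogonal_residual M x : M \is hermsymmx -> enorm x = 1 ->
  orthogonal_to (M *m x - (qform M x)%:C *: x) x.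
Proof.
move=> HM x1; rewrite /orthogonal_to ctmxD.
rewrite -scaleNr -rmorphN/= ctmxZ conjc_real ctmxM (ctmx_herm HM) mulmxDl.
rewrite herm_form_real// -scalemxAl.
have := herm_form_real x hermsymmx1; rewrite mulmx1 -enorm_sqr x1 expr1n => ->.
by rewrite -scalemx1 rmorphN scaleNr/= scalemx1 subrr.
Qed.

Lemma reform_mulmx M y x : reform 1%:M y (M *m x) = reform M y x.
Proof. by rewrite /reform mulmx1 mulmxA. Qed.

(** The residual of x is itself an admissible direction, and tested against
    itself it has norm zero. *)
Lemma eigenvector_of_stationary M x : M \is hermsymmx -> enorm x = 1 ->
  (forall d, orthogonal_to d x -> reform M d x = 0) -> M *m x = (qform M x)%:C *: x.
Proof.
move=> HM x1 stat; have ox := orthogonal_residual HM x1.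
set d := M *m x - _ in ox; apply/eqP; rewrite -subr_eq0 -/d.
rewrite -enorm_eq0 -sqrf_eq0 enorm_sqr /qform {2}/d.
rewrite reformDr reform_mulmx (stat d ox) add0r -scaleNr -rmorphN/= reformZr.
by rewrite reform1_orthogonal// mulr0.
Qed.

(** It suffices to bound the form on the orthogonal complement of x, since
    eigenvectors for distinct eigenvalues of a Hermitian matrix are orthogonal. *)
Lemma largest_eigenvalue_orthogonal M x (l : R) : M \is hermsymmx -> x != 0 ->
  M *m x = l%:C *: x ->
  (forall d, orthogonal_to d x -> qform M d <= l * enorm d ^+ 2) ->
  largest_eigenvalue M l.
Proof.
move=> HM x0 Mx le; split.
  apply/eigenvalueP; exists (x^t* ); last first.
    by apply: contra x0 => /eqP xs0; rewrite -(trmxCK x) xs0 trmx0 map_mx0.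
  by have := congr1 (fun B : 'cV[C]_n => B^t* ) Mx; rewrite ctmxM (ctmx_herm HM) ctmxZ conjc_real.
move=> mu /eigenvalueP[v vM v0].
(* The eigenvector v is a row vector; y is the column vector with y^H = v. *)
pose y := v^t*.
have yv : y^t* = v by exact: trmxCK.
have y0 : y != 0 by apply: contra v0 => /eqP y0; rewrite -yv y0 trmx0 map_mx0.
have ny : 0 < enorm y ^+ 2 by rewrite exprn_gt0// lt_def enorm_eq0 y0 enorm_ge0.
(* mu is the Rayleigh quotient of y, hence real. *)
have muE : mu = (qform M y / enorm y ^+ 2)%:C.
  have := herm_form_real y HM; rewrite yv vM -scalemxAl.
  have := herm_form_real y hermsymmx1; rewrite yv mulmx1 => ->.
  rewrite scale_scalar_mx => /(congr1 (fun B : 'M[C]_1 => B 0 0)); rewrite !mxE eqxx !mulr1n.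
  rewrite -enorm_sqr => muE; rewrite rmorphM/= -muE fmorphV/= mulfK//.
  by apply/eqP => /complexI E; rewrite E ltxx in ny.
have [->//|mul] := eqVneq mu l%:C.
have oy : orthogonal_to y x.
  have E : mu *: (v *m x) = l%:C *: (v *m x).
    by rewrite scalemxAl -vM -mulmxA Mx scalemxAr.
  have /eqP : (mu - l%:C) *: (v *m x) = 0 by rewrite scalerBl E subrr.
  by rewrite scaler_eq0 subr_eq0 (negPf mul)/= => /eqP; rewrite /orthogonal_to yv.
by rewrite muE lecR ler_pdivrMr// le.
Qed.

Lemma stable_strict_local_maximizer (h_derivable : forall (i : 'I_m) (t : R), derivable (h i) t 1)
  (dphi : forall (i : 'I_m) (t : R), is_derive t 1 (phi i) (h i t)) x :
  stable_eigenvector A h x -> aMax_strict_local_maximizer (Fobj A phi) x.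
Proof.
move=> [[x1 [l [Hx _]]] stable]; split=> //.
have [c c0 cP] := coercive_quadratic (@continuous_varphi R m n A h x) (varphiZ A h x) stable.
have c2 : 0 < c / 2 by rewrite divr_gt0.
have [delta delta0 P] := Fobj_expansion x1 A_herm h_derivable dphi c2.
exists delta => // d d0 dx dd; have := P d dx dd.
have -> : reform (Hmx A h x) d x = 0.
  by rewrite -reform_mulmx Hx reformZr reform1_orthogonal// mulr0.
have nd : 0 < enorm d ^+ 2 by rewrite exprn_gt0// lt_def enorm_eq0 d0 enorm_ge0.
rewrite mulr0 add0r ler_norml => /andP[_]; have := cP d dx.
have : 0 < c * enorm d ^+ 2 by rewrite mulr_gt0.
move: (Fobj _ _ _) (Fobj _ _ _) (varphi _ _ _ _) (enorm d ^+ 2) => F1 F0 p N; lra.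
Qed.

(** The first- and second-order necessary conditions on the sphere. *)
Lemma second_order_necessary (h_derivable : forall (i : 'I_m) (t : R), derivable (h i) t 1)
  (dphi : forall (i : 'I_m) (t : R), is_derive t 1 (phi i) (h i t)) x :
  aMax_local_maximizer (Fobj A phi) x -> forall d, orthogonal_to d x ->
  reform (Hmx A h x) d x = 0 /\ varphi A h d x <= 0.
Proof.
move=> [x1 [eps eps0 xmax]] d dx; apply: nonpos_quadratic => e e0.
have nd : 0 < enorm d ^+ 2 + 1 by have := sqr_ge0 (enorm d); lra.
have nd1 : 0 < enorm d + 1 by have := enorm_ge0 d; lra.
have e'0 : 0 < e / (enorm d ^+ 2 + 1) by rewrite divr_gt0.
have [delta delta0 P] := Fobj_expansion x1 A_herm h_derivable dphi e'0.
exists (Num.min delta eps / (enorm d + 1)); first by rewrite divr_gt0// lt_min delta0.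
move=> t; rewrite ler_pdivlMr// => td.
have otd : orthogonal_to (t%:C *: d) x by rewrite /orthogonal_to ctmxZ -scalemxAl dx scaler0.
have : enorm (t%:C *: d) <= Num.min delta eps.
  by rewrite enormZ; apply: le_trans td; rewrite ler_wpM2l// lerDl.
rewrite le_min => /andP[t1 t2].
have := P _ otd t1; rewrite ler_norml => /andP[+ _].
have := xmax _ otd t2.
rewrite reformZl varphiZ enormZ exprMn real_normK ?num_real//.
have : e / (enorm d ^+ 2 + 1) * (t ^+ 2 * enorm d ^+ 2) <= e * t ^+ 2.
  move: (t ^+ 2) (sqr_ge0 t) (enorm d ^+ 2) nd => T T0 N nd.
  have -> : e / (N + 1) * (T * N) = e * T * (N / (N + 1)) by ring.
  by rewrite ler_piMr ?mulr_ge0 ?(ltW e0)// ler_pdivrMr// mul1r lerDl.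
move: (Fobj A phi x) (Fobj A phi _) (2 * _ + _ * varphi _ _ _ _) => F0 F1 G.
move: (_ / _ * _) (e * t ^+ 2) => E B; lra.
Qed.

Lemma local_maximizer_weakly_stable (h_derivable : forall (i : 'I_m) (t : R), derivable (h i) t 1)
  (h_nondecreasing : forall i : 'I_m, {homo h i : s t / s <= t})
  (dphi : forall (i : 'I_m) (t : R), is_derive t 1 (phi i) (h i t)) x :
  aMax_local_maximizer (Fobj A phi) x -> weakly_stable_eigenvector A h x.
Proof.
move=> xmax; have [x1 _] := xmax.
have nec := second_order_necessary h_derivable dphi xmax.
have HM := Hmx_herm x.
have Hx : Hmx A h x *m x = (qform (Hmx A h x) x)%:C *: x.
  by apply: eigenvector_of_stationary => // d /nec[].
split; last by move=> d _ /nec[].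
split=> //; exists (qform (Hmx A h x) x); split=> //.
apply: largest_eigenvalue_orthogonal (HM) _ Hx _.
  by rewrite -enorm_eq0 x1 oner_neq0.
move=> d /nec[_ p]; rewrite -subr_le0 -qform_shift; apply: le_trans p.
rewrite /varphi lerDl mulr_ge0// sumr_ge0// => i _.
by rewrite mulr_ge0 ?sqr_ge0// nondecreasing_derive1_ge0.
Qed.

End Optimality.

Theorem theorem2p1 (R : realType) (m n : nat)
  (A : 'I_m -> 'M[R[i]]_n) (h phi : 'I_m -> R -> R)
  (A_herm : forall i : 'I_m, A i \is hermsymmx)
  (h_derivable : forall (i : 'I_m) (t : R), derivable (h i) t 1)
  (h_nondecreasing : forall i : 'I_m, {homo h i : s t / s <= t})
  (phi_antiderivative : forall (i : 'I_m) (t : R), is_derive t 1 (phi i) (h i t))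
  (x : 'cV[R[i]]_n) (x_unit : enorm x = 1) :
  (stable_eigenvector A h x -> aMax_strict_local_maximizer (Fobj A phi) x) /\
  (aMax_local_maximizer (Fobj A phi) x -> weakly_stable_eigenvector A h x).
Proof.
split; first exact: stable_strict_local_maximizer.
exact: local_maximizer_weakly_stable.
Qed.
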